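(* Let $V$ be a separable left quaternionic Hilbert space and let $\Phi=\{\phi_k\}_{k\in I}$ be a countable family of vectors in $V$. Let $\mathfrak{C}\in\mathcal{GL}(V)$ be self-adjoint and diagonal on $\Phi$, and assume that it generates a controlled frame, i.e. that $\Phi$ is a $\mathfrak{C}$-controlled frame. Then the sequence $\omega=\{\omega_k\}_{k\in I}$ which verifies the relation $\mathfrak{C}\phi_k=\omega_k\phi_k$ for all $k\in I$ is semi-normalized and positive. Furthermore, $$\mathfrak{C}=\mathbf{M}_{\omega,\widetilde{\Phi},\Phi},$$ where $\widetilde{\Phi}=\{L^{-1}\phi_k\}_{k\in I}$ and $L$ is the frame operator for $\Phi$; that is, $\mathfrak{C}\psi=\sum_{k\in I}\omega_k\langle\psi|\phi_k\rangle L^{-1}\phi_k$ for all $\psi\in V$.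
   Context: $\mathbb{H}$ denotes the quaternions, with conjugation $q\mapsto\overline{q}$. A left quaternionic Hilbert space $V$ is a left $\mathbb{H}$-vector space with an inner product $\langle\cdot|\cdot\rangle:V\times V\to\mathbb{H}$ that is additive in each variable and satisfies $\overline{\langle f|g\rangle}=\langle g|f\rangle$, $\langle f|f\rangle>0$ for $f\ne0$, $\langle qf|g\rangle=q\langle f|g\rangle$, $\langle f|qg\rangle=\langle f|g\rangle\overline{q}$, and is complete for the norm given by $\|f\|^2=\langle f|f\rangle$. An operator $T$ is left linear if it is additive and $T(qf)=q(Tf)$ for $q\in\mathbb{H}$. The adjoint $T^\dagger$ is defined by $\langle\psi|T\phi\rangle=\langle T^\dagger\psi|\phi\rangle$ for all $\phi,\psi\in V$; $T$ is self-adjoint if $T=T^\dagger$. $\mathcal{GL}(V)$ is the set of bounded left linear operators $V\to V$ having a bounded inverse. The operator $\mathfrak{C}$ is diagonal on $\Phi=\{\phi_k\}_{k\in I}$ if for each $k\in I$ there is a scalar $\omega_k$ with $\mathfrak{C}\phi_k=\omega_k\phi_k$. The sequence $\{\omega_k\}$ is positive if each $\omega_k$ is a positive real number. A countable family $\{\phi_k\}_{k\in I}$ in $V$ is a frame for $V$ if there are constants $A,B>0$ with $A\|\psi\|^2\le\sum_{k\in I}|\langle\psi|\phi_k\rangle|^2\le B\|\psi\|^2$ for all $\psi\in V$; its frame operator is $L:V\to V$, $L\psi=\sum_{k\in I}\langle\psi|\phi_k\rangle\phi_k$, which is invertible. For $\mathfrak{C}\in\mathcal{GL}(V)$, a countable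 family $\{\phi_k\}_{k\in I}$ in $V$ is a $\mathfrak{C}$-controlled frame if there are constants $0<A_{\mathfrak{C}S}\le B_{\mathfrak{C}S}<\infty$ such that for all $\psi\in V$ $$A_{\mathfrak{C}S}\|\psi\|^2\le\sum_{k\in I}\langle\psi|\phi_k\rangle\langle\mathfrak{C}\phi_k|\psi\rangle\le B_{\mathfrak{C}S}\|\psi\|^2.$$ (A $\mathfrak{C}$-controlled frame is in particular a frame, so $L$ above makes sense.) A sequence $\{\zeta_k\}$ is semi-normalized if there are bounds $b\ge a>0$ with $a\le|\zeta_k|\le b$ for all $k$. For frames $\{\psi_k\}_{k\in I}$ and $\{\phi_k\}_{k\in I}$ and a bounded sequence $\mathbf{m}=\{m_k\}\in\ell^\infty(I)$, the frame multiplier is $\mathbf{M}_{\mathbf{m},\{\phi_k\},\{\psi_k\}}(h)=\sum_{k\in I}m_k\langle h|\psi_k\rangle\phi_k$.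
   Formalization: If some φ_k = 0 then ω_k is arbitrary, so the claim fails for some ω. Here every ω verifying the relation is semi-normalized and positive on the indices with φ_k ≠ 0 and gives the multiplier identity, and some ω verifying it is semi-normalized and positive on all of I. *)

(* Defs.v *)
From HB Require Import structures.
From mathcomp Require Import all_boot all_order all_algebra finmap.
From mathcomp Require Import ring lra.
From mathcomp Require Import all_classical all_reals all_analysis.
From mathcomp.analysis.showcase Require Import summability.

Set Implicit Arguments.
Unset Strict Implicit.
Unset Printing Implicit Defensive.

Import Order.TTheory GRing.Theory Num.Theory.
Import numFieldNormedType.Exports.

Local Open Scope classical_set_scope.
Local Open Scope ring_scope.

(* [Quat a b c d] is a + b i + c j + d k. *)
Record quat (R : Type) := Quat { qre : R; qi : R; qj : R; qk : R }.

Section QuatChoice.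
Variable R : Type.

Definition quat_to_prod (x : quat R) : R * R * R * R :=
  (qre x, qi x, qj x, qk x).

Definition prod_to_quat (x : R * R * R * R) : quat R :=
  let: (a, b, c, d) := x in Quat a b c d.

Lemma quat_to_prodK : cancel quat_to_prod prod_to_quat.
Proof. by case. Qed.

End QuatChoice.

HB.instance Definition _ (R : eqType) :=
  Equality.copy (quat R) (can_type (@quat_to_prodK R)).
HB.instance Definition _ (R : choiceType) :=
  Choice.copy (quat R) (can_type (@quat_to_prodK R)).

Section QuatRing.
Variable R : realType.
Implicit Types x y z : quat R.

Definition qadd x y :=
  Quat (qre x + qre y) (qi x + qi y) (qj x + qj y) (qk x + qk y).

Definition qopp x := Quat (- qre x) (- qi x) (- qj x) (- qk x).

Definition qmul x y :=
  Quat (qre x * qre y - qi x * qi y - qj x * qj y - qk x * qk y)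
       (qre x * qi y + qi x * qre y + qj x * qk y - qk x * qj y)
       (qre x * qj y - qi x * qk y + qj x * qre y + qk x * qi y)
       (qre x * qk y + qi x * qj y - qj x * qi y + qk x * qre y).

Definition qreal (a : R) : quat R := Quat a 0 0 0.

Definition qconj x := Quat (qre x) (- qi x) (- qj x) (- qk x).

Definition qnorm x : R :=
  Num.sqrt (qre x ^+ 2 + qi x ^+ 2 + qj x ^+ 2 + qk x ^+ 2).

Lemma qaddA : associative qadd.
Proof. by move=> x y z; rewrite /qadd /= !addrA. Qed.

Lemma qaddC : commutative qadd.
Proof.
move=> x y; rewrite /qadd (addrC (qre x)) (addrC (qi x)).
by rewrite (addrC (qj x)) (addrC (qk x)).
Qed.

Lemma qadd0 : left_id (qreal 0) qadd.
Proof. by case=> a b c d; rewrite /qadd /= !add0r. Qed.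

Lemma qaddN : left_inverse (qreal 0) qopp qadd.
Proof. by case=> a b c d; rewrite /qadd /qopp /= !addNr. Qed.

HB.instance Definition _ :=
  GRing.isZmodule.Build (quat R) qaddA qaddC qadd0 qaddN.

Lemma qmulA : associative qmul.
Proof.
by move=> [a b c d] [e f g h] [k l m n]; rewrite /qmul /=; congr Quat; ring.
Qed.

Lemma qmul1 : left_id (qreal 1) qmul.
Proof. by move=> [a b c d]; rewrite /qmul /=; congr Quat; ring. Qed.

Lemma qmulr1 : right_id (qreal 1) qmul.
Proof. by move=> [a b c d]; rewrite /qmul /=; congr Quat; ring. Qed.

Lemma qmulDl : left_distributive qmul qadd.
Proof.
by move=> [a b c d] [e f g h] [k l m n]; rewrite /qmul /qadd /=; congr Quat; ring.
Qed.

Lemma qmulDr : right_distributive qmul qadd.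
Proof.
by move=> [a b c d] [e f g h] [k l m n]; rewrite /qmul /qadd /=; congr Quat; ring.
Qed.

Lemma qone_neq0 : qreal 1 != 0 :> quat R.
Proof. by apply/eqP => -[/eqP]; rewrite oner_eq0. Qed.

HB.instance Definition _ := GRing.Zmodule_isNzRing.Build (quat R)
  qmulA qmul1 qmulr1 qmulDl qmulDr qone_neq0.

Lemma qnorm_triangle x y : qnorm (x + y) <= qnorm x + qnorm y.
Proof.
case: x y => [a b c d] [e f g h]; rewrite /qnorm /=.
set X := a ^+ 2 + b ^+ 2 + c ^+ 2 + d ^+ 2.
set Y := e ^+ 2 + f ^+ 2 + g ^+ 2 + h ^+ 2.
have X0 : 0 <= X by rewrite !addr_ge0 ?sqr_ge0.
have Y0 : 0 <= Y by rewrite !addr_ge0 ?sqr_ge0.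
have S0 : 0 <= Num.sqrt X + Num.sqrt Y by rewrite addr_ge0 ?sqrtr_ge0.
rewrite -(ger0_norm S0) -sqrtr_sqr ler_wsqrtr // [leRHS]sqrrD !sqr_sqrtr //.
have CS : a * e + b * f + c * g + d * h <= Num.sqrt X * Num.sqrt Y.
  rewrite -sqrtrM // (le_trans (ler_norm _)) // -sqrtr_sqr ler_wsqrtr //.
  rewrite -subr_ge0.
  have -> : X * Y - (a * e + b * f + c * g + d * h) ^+ 2 =
    (a * f - b * e) ^+ 2 + (a * g - c * e) ^+ 2 + (a * h - d * e) ^+ 2 +
    (b * g - c * f) ^+ 2 + (b * h - d * f) ^+ 2 + (c * h - d * g) ^+ 2.
    by rewrite /X /Y; ring.
  by rewrite !addr_ge0 ?sqr_ge0.
rewrite -mulr_natl /X /Y; lra.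
Qed.

Lemma qnorm_eq0 x : qnorm x = 0 -> x = 0.
Proof.
case: x => [a b c d]; rewrite /qnorm /= => /eqP; rewrite sqrtr_eq0 => H.
have := sqr_ge0 a; have := sqr_ge0 b; have := sqr_ge0 c; have := sqr_ge0 d.
move=> d0 c0 b0 a0.
have [ae be ce de] : [/\ a ^+ 2 = 0, b ^+ 2 = 0, c ^+ 2 = 0 & d ^+ 2 = 0].
  by split; lra.
move: ae be ce de => /eqP + /eqP + /eqP + /eqP.
by rewrite !sqrf_eq0 => /eqP -> /eqP -> /eqP -> /eqP ->.
Qed.

Lemma qnormMn x n : qnorm (x *+ n) = qnorm x *+ n.
Proof.
have -> : x *+ n = Quat (qre x *+ n) (qi x *+ n) (qj x *+ n) (qk x *+ n).
  elim: n => [|n IH]; first by [].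
  by rewrite !mulrS IH.
case: x => [a b c d]; rewrite /qnorm /= !exprMn_n -!mulrnDl.
by rewrite -mulr_natr sqrtrM ?addr_ge0 ?sqr_ge0 // natrX sqrtr_sqr
  ger0_norm ?ler0n // mulr_natr.
Qed.

Lemma qnormN x : qnorm (- x) = qnorm x.
Proof. by case: x => [a b c d]; rewrite /qnorm /= !sqrrN. Qed.

HB.instance Definition _ := Num.Zmodule_isNormed.Build R (quat R)
  qnorm_triangle qnorm_eq0 qnormMn qnormN.

HB.instance Definition _ :=
  PseudoMetric.copy (quat R) (pseudoMetric_normed (quat R)).

HB.instance Definition _ := isPointed.Build (quat R) 0.

HB.instance Definition _ :=
  NormedZmod_PseudoMetric_eq.Build R (quat R) erefl.

End QuatRing.

(* Left quaternionic Hilbert space. The left H-module structure is given by an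
   explicit operation [qscale]: the library's joins of topology and [lmodType]
   only allow commutative scalars. [qdot_norm] says that <f|f> is the real
   number ||f||^2; since [`|_|] is a norm, this subsumes <f|f> > 0 for f <> 0. *)
HB.mixin Record isQHilbert (R : realType) V & PseudoMetricNormedZmod R V := {
  qscale : quat R -> V -> V;
  qscaleA : forall p q f, qscale p (qscale q f) = qscale (p * q) f;
  qscale1 : forall f, qscale 1 f = f;
  qscaleDr : forall q f g, qscale q (f + g) = qscale q f + qscale q g;
  qscaleDl : forall p q f, qscale (p + q) f = qscale p f + qscale q f;
  qdot : V -> V -> quat R;
  qdotDl : forall f g h, qdot (f + g) h = qdot f h + qdot g h;
  qdotDr : forall f g h, qdot f (g + h) = qdot f g + qdot f h;
  qdotC : forall f g, qconj (qdot f g) = qdot g f;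
  qdotZl : forall q f g, qdot (qscale q f) g = q * qdot f g;
  qdotZr : forall q f g, qdot f (qscale q g) = qdot f g * qconj q;
  qdot_norm : forall f, qdot f f = qreal (`|f| ^+ 2);
  qcauchy_cvg : forall F : set_system V, ProperFilter F -> cauchy F -> cvg F
}.

#[short(type="qHilbertType")]
HB.structure Definition QHilbert (R : realType) :=
  {V of PseudoMetricNormedZmod R V & isQHilbert R V}.

Notation "q *h: f" := (qscale q f) (at level 40, left associativity).

Definition separable (T : topologicalType) :=
  exists2 D : set T, countable D & dense D.

(* Sum over an unordered index set: limit of the net of finite partial sums. *)
Definition has_sum (R : numDomainType) (I : choiceType)
    (W : pseudoMetricNormedZmodType R) (f : I -> W) (s : W) :=
  partial_sum f @ totally --> s.

Section Operators.
Variables (R : realType) (V : qHilbertType R).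

Definition bounded_op (T : V -> V) :=
  exists M : R, forall f, `|T f| <= M * `|f|.

Definition left_linear (T : V -> V) :=
  {morph T : f g / f + g} /\ forall q : quat R, {morph T : f / q *h: f}.

Definition in_GL (T : V -> V) :=
  [/\ left_linear T, bounded_op T &
    exists S : V -> V, [/\ bounded_op S, cancel T S & cancel S T]].

Definition is_adjoint (T Tadj : V -> V) :=
  forall f g : V, qdot g (T f) = qdot (Tadj g) f.

Definition self_adjoint (T : V -> V) := is_adjoint T T.

End Operators.

Section Frames.
Variables (R : realType) (V : qHilbertType R) (I : countType).
Implicit Types (phi psi : I -> V) (om : I -> quat R).

Definition diagonal_with (C : V -> V) phi om :=
  forall k, C (phi k) = om k *h: phi k.

Definition diagonal_on (C : V -> V) phi :=
  forall k, exists w : quat R, C (phi k) = w *h: phi k.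

Definition controlled_frame (C : V -> V) phi :=
  exists A B : R, [/\ 0 < A, A <= B &
    forall f : V, exists2 s : R,
      has_sum (fun k => qdot f (phi k) * qdot (C (phi k)) f) (qreal s) &
      A * `|f| ^+ 2 <= s <= B * `|f| ^+ 2].

Definition frame_operator phi (f : V) : V :=
  lim (partial_sum (fun k => qdot f (phi k) *h: phi k) @ totally).

(* [pinv setT L] is a choice of preimage, hence the inverse of a bijective L. *)
Definition canonical_dual phi (k : I) : V :=
  pinv [set: V] (frame_operator phi) (phi k).

(* M is the multiplier M_{m, phi, psi}; convergence of the series is part of
   the assertion. *)
Definition is_frame_multiplier (m : I -> quat R) phi psi (M : V -> V) :=
  forall h : V, has_sum (fun k => (m k * qdot h (psi k)) *h: phi k) (M h).

(* The two predicates below are relative to a set J of indices, because the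
   equation C phi_k = w phi_k leaves w arbitrary when phi_k = 0. *)
Definition semi_normalized_on (J : set I) om :=
  exists a b : R, [/\ 0 < a, a <= b & forall k, J k -> a <= `|om k| <= b].

Definition positive_on (J : set I) om :=
  forall k, J k -> exists2 r : R, 0 < r & om k = qreal r.

End Frames.

(* Main.v *)
(* C is self-adjoint, so each omega_k with phi_k <> 0 is real and eigenvectors
   of distinct eigenvalues are orthogonal. In the controlled sum at f = phi_j
   all terms therefore carry the same factor omega_j, and the lower bound forces
   omega_j > 0; boundedness of C and C^-1 bounds omega_j from both sides. Hence
   Phi is a frame. Its frame operator L is bounded below, which makes the
   residuals of the iteration f + t (g - L f) decay geometrically, so L is onto.
   Finally omega_k <h|phi_k> = <C h|phi_k>, so the series of the multiplier is
   the image under L^-1 of the series of L (C h), and it sums to C h. *)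
Require Import Defs.
From mathcomp Require Import all_boot all_order all_algebra finmap.
From mathcomp Require Import ring lra.
From mathcomp Require Import all_classical all_reals all_analysis.
From mathcomp.analysis.showcase Require Import summability.

Set Implicit Arguments.
Unset Strict Implicit.
Unset Printing Implicit Defensive.

Import Order.TTheory GRing.Theory Num.Theory.
Import numFieldNormedType.Exports.

Local Open Scope classical_set_scope.
Local Open Scope ring_scope.

(** * Quaternion norm, conjugation and central reals *)

Section Quaternions.
Variable R : realType.
Implicit Types x y : quat R.

Lemma qreD : {morph @qre R : x y / x + y}.
Proof. by []. Qed.

Lemma qreN : {morph @qre R : x / - x}.
Proof. by []. Qed.

Lemma qre_sum (J : Type) (r : seq J) (F : J -> quat R) :
  qre (\sum_(i <- r) F i) = \sum_(i <- r) qre (F i).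
Proof. exact: (big_morph (@qre R) qreD). Qed.

Lemma sqr_normq x : `|x| ^+ 2 = qre x ^+ 2 + qi x ^+ 2 + qj x ^+ 2 + qk x ^+ 2.
Proof. by rewrite -[LHS]/(qnorm x ^+ 2) sqr_sqrtr // !addr_ge0 ?sqr_ge0. Qed.

Lemma ler_qre x : `|qre x| <= `|x|.
Proof.
rewrite -(@ler_pXn2r R 2) ?nnegrE // sqr_normq real_normK ?num_real //.
by have := sqr_ge0 (qi x); have := sqr_ge0 (qj x); have := sqr_ge0 (qk x); lra.
Qed.

Lemma normq_real (r : R) : `|qreal r| = `|r|.
Proof.
apply: (@pexpIrn R 2); rewrite ?nnegrE // sqr_normq.
by rewrite real_normK ?num_real //=; ring.
Qed.

Lemma qrealM (r s : R) : qreal (r * s) = qreal r * qreal s.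
Proof. by congr Quat; rewrite /=; ring. Qed.

Lemma qconj_real (r : R) : qconj (qreal r) = qreal r.
Proof. by rewrite /qconj /= !oppr0. Qed.

Lemma qmul_realC (r : R) x : qreal r * x = x * qreal r.
Proof. by case: x => a b c d; congr Quat; rewrite /=; ring. Qed.

Lemma qreMreal (r : R) x : qre (qreal r * x) = r * qre x.
Proof. by case: x => a b c d /=; ring. Qed.

Lemma qmul_conj x : x * qconj x = qreal (`|x| ^+ 2).
Proof. by rewrite sqr_normq; case: x => a b c d; congr Quat => /=; ring. Qed.

Lemma normq_conj x : `|qconj x| = `|x|.
Proof.
by apply: (@pexpIrn R 2); rewrite ?nnegrE // !sqr_normq /=; ring.
Qed.

(** Young's inequality: the gap is a sum of four squares over [2 * t], with signs dictated by the
    real part of a quaternion product. *)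
Lemma qre_mul_le (t : R) x y : 0 < t ->
  qre (x * y) <= (t * `|x| ^+ 2 + `|y| ^+ 2 / t) / 2.
Proof.
move=> t0; rewrite !sqr_normq -subr_ge0.
have -> : (t * (qre x ^+ 2 + qi x ^+ 2 + qj x ^+ 2 + qk x ^+ 2) +
     (qre y ^+ 2 + qi y ^+ 2 + qj y ^+ 2 + qk y ^+ 2) / t) / 2 - qre (x * y) =
  ((t * qre x - qre y) ^+ 2 + (t * qi x + qi y) ^+ 2 +
   (t * qj x + qj y) ^+ 2 + (t * qk x + qk y) ^+ 2) / (2 * t).
  by case: x y => [a b c d] [e f g h] /=; field; rewrite gt_eqF.
by rewrite divr_ge0 ?mulr_ge0 ?(ltW t0) // !addr_ge0 ?sqr_ge0.
Qed.

End Quaternions.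

#[local] Existing Instance totally_filter.

(** * Unordered sums as limits over finite index sets *)

Section HasSum.
Variables (R : realType) (I : choiceType).

Lemma partial_sumE (W : zmodType) (f : I -> W) (A : {fset I}) :
  partial_sum f A = \sum_(k <- A) f k.
Proof. by rewrite big_seq_fsetE. Qed.

Lemma has_sumP (W : pseudoMetricNormedZmodType R) (f : I -> W) (s : W) :
  has_sum f s <-> forall e : R, 0 < e -> exists A0 : {fset I},
    forall A : {fset I}, (A0 `<=` A)%fset -> `|s - \sum_(k <- A) f k| < e.
Proof.
rewrite /has_sum cvgrPdist_lt; split=> H e e0.
  have [A0 _ HA] := H _ e0; exists A0 => A A0A.
  by have := HA _ A0A; rewrite /= partial_sumE.
have [A0 HA] := H _ e0; exists A0 => // A /= A0A.
by rewrite partial_sumE; exact: HA.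
Qed.

Lemma has_sum_unique (W : pseudoMetricNormedZmodType R) (f : I -> W) (s t : W) :
  has_sum f s -> has_sum f t -> s = t.
Proof. by apply: cvg_unique; exact: norm_hausdorff. Qed.

Lemma has_sumD (W : pseudoMetricNormedZmodType R) (f g : I -> W) (s t : W) :
  has_sum f s -> has_sum g t -> has_sum (fun k => f k + g k) (s + t).
Proof.
move=> /has_sumP fs /has_sumP gt; apply/has_sumP => e e0.
have e20 : 0 < e / 2 by rewrite divr_gt0.
have [A HA] := fs _ e20; have [B HB] := gt _ e20.
exists (A `|` B)%fset => D; rewrite fsubUset => /andP[AD BD].
rewrite big_split opprD addrACA (le_lt_trans (ler_normD _ _)) //.
by rewrite [ltRHS]splitr ltrD ?HA ?HB.
Qed.

Lemma has_sum_norm_le (W : pseudoMetricNormedZmodType R) (f : I -> W) (s : W)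
    (M : R) :
  has_sum f s -> (forall A : {fset I}, `|\sum_(k <- A) f k| <= M) -> `|s| <= M.
Proof.
move=> /has_sumP fs fM; apply/ler_addgt0Pr => e e0.
have [A /(_ _ (fsubset_refl A))/ltW HA] := fs _ e0.
rewrite -(subrK (\sum_(k <- A) f k) s) (le_trans (ler_normD _ _)) //.
by rewrite addrC lerD.
Qed.

Lemma has_sum_qreal (u : I -> R) (s : R) :
  has_sum (fun k => qreal (u k)) (qreal s) -> has_sum u s.
Proof.
move=> /has_sumP us; apply/has_sumP => e /us[A HA]; exists A => B /HA.
by apply: le_lt_trans; rewrite (le_trans _ (ler_qre _)) // qreD qreN qre_sum.
Qed.

Lemma fsum_subset (W : zmodType) (f : I -> W) (A B : {fset I}) : (A `<=` B)%fset ->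
  \sum_(k <- B) f k = \sum_(k <- A) f k + \sum_(k <- (B `\` A)%fset) f k.
Proof.
move=> AB; rewrite (big_fsetID _ (mem A)) /=; congr (_ + _).
  apply: eq_fbigl => k; rewrite !inE /=.
  by case: (boolP (k \in A)) => [/(fsubsetP AB)->|_]; rewrite ?andbF.
by apply: eq_fbigl => k; rewrite !inE andbC.
Qed.

Lemma fsum_le_has_sum (u : I -> R) (s : R) (A : {fset I}) :
  (forall k, 0 <= u k) -> has_sum u s -> \sum_(k <- A) u k <= s.
Proof.
move=> u0 /has_sumP us; apply/ler_addgt0Pr => e /us[B HB].
have /HB := fsubsetUr A B; rewrite (fsum_subset _ (fsubsetUl A B)).
rewrite ltr_norml => /andP[+ _].
have : 0 <= \sum_(k <- ((A `|` B) `\` A)%fset) u k by rewrite sumr_ge0.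
lra.
Qed.

(** A finite set whose sum is within [e] of the supremum leaves less than [e] for any indices added
    to it. This feeds the Cauchy criterion for synthesis. *)
Lemma bounded_fsum_tail (u : I -> R) (M : R) : (forall k, 0 <= u k) ->
  (forall A : {fset I}, \sum_(k <- A) u k <= M) ->
  forall e, 0 < e -> exists A : {fset I}, forall B : {fset I}, (A `<=` B)%fset ->
    \sum_(k <- (B `\` A)%fset) u k < e.
Proof.
move=> u0 uM e e0; pose S := [set \sum_(k <- A) u k | A in [set: {fset I}]].
have Ssup : has_sup S.
  split; first by exists (\sum_(k <- fset0) u k); exists fset0.
  by exists M => _ [A _ <-]; exact: uM.
have [_ [A _ <-] HA] := sup_adherent e0 Ssup; exists A => B AB.
have : \sum_(k <- B) u k <= sup S by apply: ub_le_sup; [exact: Ssup.2|exists B].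
rewrite (fsum_subset _ AB); move: HA; lra.
Qed.

End HasSum.

(** * Inner product and its real part *)

Section InnerProduct.
Variables (R : realType) (V : qHilbertType R).
Implicit Types (f g h : V) (q : quat R).

Lemma qscale0r q : q *h: (0 : V) = 0.
Proof. by apply: (addrI (q *h: (0 : V))); rewrite -qscaleDr !addr0. Qed.

Lemma qscaleN q f : q *h: (- f) = - (q *h: f).
Proof. by apply: (addrI (q *h: f)); rewrite -qscaleDr !subrr qscale0r. Qed.

Lemma qscale_sum (J : Type) (r : seq J) q (F : J -> V) :
  q *h: (\sum_(i <- r) F i) = \sum_(i <- r) q *h: F i.
Proof. exact: (big_morph _ (qscaleDr q) (qscale0r q)). Qed.

Lemma qdot0l g : qdot 0 g = 0.
Proof. by apply: (addrI (qdot 0 g)); rewrite -qdotDl !addr0. Qed.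

Lemma qdot0r f : qdot f 0 = 0.
Proof. by apply: (addrI (qdot f 0)); rewrite -qdotDr !addr0. Qed.

Lemma qdot_suml (J : Type) (r : seq J) (F : J -> V) g :
  qdot (\sum_(i <- r) F i) g = \sum_(i <- r) qdot (F i) g.
Proof.
by apply: (big_morph (fun f => qdot f g)) => [f h|]; rewrite ?qdotDl ?qdot0l.
Qed.

(** Follows from [qdot_norm]: the real number [|f|^2] is central, so it can be pulled out from
    between [q] and its conjugate. *)
Lemma normr_qscale q f : `|q *h: f| = `|q| * `|f|.
Proof.
apply: (@pexpIrn R 2); rewrite ?nnegrE ?mulr_ge0 //.
have : qdot (q *h: f) (q *h: f) = qreal ((`|q| * `|f|) ^+ 2).
  by rewrite qdotZl qdotZr qdot_norm mulrA -qmul_realC -mulrA qmul_conj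
    -qrealM exprMn mulrC.
by rewrite qdot_norm => -[].
Qed.

Definition rdot f g : R := qre (qdot f g).

Lemma rdotDl f g h : rdot (f + g) h = rdot f h + rdot g h.
Proof. by rewrite /rdot qdotDl. Qed.

Lemma rdotC f g : rdot f g = rdot g f.
Proof. by rewrite /rdot -(qdotC f g). Qed.

Lemma rdotNl f g : rdot (- f) g = - rdot f g.
Proof. by apply: (addrI (rdot f g)); rewrite -rdotDl !subrr /rdot qdot0l. Qed.

Lemma rdot_norm f : rdot f f = `|f| ^+ 2.
Proof. by rewrite /rdot qdot_norm. Qed.

Lemma rdotZl (t : R) f g : rdot (qreal t *h: f) g = t * rdot f g.
Proof. by rewrite /rdot qdotZl qreMreal. Qed.

Lemma sqr_normB f g : `|f - g| ^+ 2 = `|f| ^+ 2 - 2 * rdot f g + `|g| ^+ 2.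
Proof.
rewrite -!rdot_norm rdotDl !(rdotC _ (f - g)) !rdotDl !rdotNl.
rewrite !(rdotC _ (- g)) !rdotNl.
by rewrite (rdotC g f); ring.
Qed.

(** Cauchy-Schwarz for the real part: rescale [f] and [g] to equal norm and expand the squared norm
    of their difference. *)
Lemma rdot_le f g : rdot f g <= `|f| * `|g|.
Proof.
have [->|g0] := eqVneq g 0; first by rewrite rdotC /rdot qdot0l normr0 mulr0.
have [->|f0] := eqVneq f 0; first by rewrite /rdot qdot0l normr0 mul0r.
have nf : 0 < `|f| by rewrite normr_gt0.
have ng : 0 < `|g| by rewrite normr_gt0.
have := sqr_ge0 `|qreal `|g| *h: f - qreal `|f| *h: g|.
rewrite sqr_normB !normr_qscale !normq_real !normr_id rdotZl rdotC rdotZl rdotC.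
have -> : (`|g| * `|f|) ^+ 2 - 2 * (`|g| * (`|f| * rdot f g)) + (`|f| * `|g|) ^+ 2
  = 2 * (`|f| * `|g|) * (`|f| * `|g| - rdot f g) by ring.
by rewrite pmulr_rge0 ?subr_ge0 // mulr_gt0 // mulr_gt0.
Qed.

Lemma normr_qdotC f g : `|qdot f g| = `|qdot g f|.
Proof. by rewrite -(qdotC f g) normq_conj. Qed.

End InnerProduct.

(** * Synthesis and frame operator of a Bessel family *)

Section Synthesis.
Variables (R : realType) (V : qHilbertType R) (I : countType).
Variables (phi : I -> V) (B : R).
Hypothesis B_gt0 : 0 < B.
Hypothesis bessel : forall (f : V) (A : {fset I}),
  \sum_(k <- A) `|qdot f (phi k)| ^+ 2 <= B * `|f| ^+ 2.

Lemma synthesis_norm_le (c : I -> quat R) (A : {fset I}) :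
  `|\sum_(k <- A) c k *h: phi k| ^+ 2 <= B * \sum_(k <- A) `|c k| ^+ 2.
Proof.
set g := \sum_(k <- A) _.
(* Young's inequality with weight [B] splits [|g|^2 = Re <g|g>]; the half
   that is quadratic in [g] is absorbed by the left-hand side. *)
have : `|g| ^+ 2 <=
    \sum_(k <- A) (B * `|c k| ^+ 2 + `|qdot g (phi k)| ^+ 2 / B) / 2.
  rewrite -rdot_norm {1}/g /rdot qdot_suml qre_sum; apply: ler_sum => k _.
  by rewrite qdotZl (normr_qdotC g) qre_mul_le.
rewrite -mulr_suml big_split /= -mulr_sumr -mulr_suml.
have := bessel g A; rewrite -ler_pdivrMl // mulrC; lra.
Qed.

(** Completeness applies: two partial sums over [A] and [D] containing [A] differ by a synthesis
    over the added indices, whose norm is controlled by the tail of the squared coefficients. *)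
Lemma synthesis_cvg (c : I -> quat R) (M : R) :
  (forall A : {fset I}, \sum_(k <- A) `|c k| ^+ 2 <= M) ->
  exists s : V, has_sum (fun k => c k *h: phi k) s.
Proof.
move=> cM.
suff : cvg (partial_sum (fun k => c k *h: phi k) @ totally).
  by move=> /cvg_ex[s ?]; exists s.
apply: qcauchy_cvg; apply: cauchy_exP => e e0.
have d0 : 0 < e ^+ 2 / B by rewrite divr_gt0 // exprn_gt0.
have [A HA] := bounded_fsum_tail (fun k => sqr_ge0 `|c k|) cM d0.
exists (\sum_(k <- A) c k *h: phi k); exists A => // D /= AD.
rewrite -ball_normE /ball_ /= partial_sumE (fsum_subset _ AD) opprD addNKr normrN.
rewrite -(@ltr_pXn2r R 2) ?nnegrE ?(ltW e0) //.
rewrite (le_lt_trans (synthesis_norm_le _ _)) // mulrC -ltr_pdivlMr //.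
exact: HA.
Qed.

Local Notation L := (frame_operator phi).

(** The Bessel bound makes the coefficients square-summable, so the [lim] defining [L] is a genuine
    limit. *)
Lemma frame_operatorP (f : V) : has_sum (fun k => qdot f (phi k) *h: phi k) (L f).
Proof.
have [s Hs] := synthesis_cvg (bessel f).
by rewrite /frame_operator (cvg_lim _ Hs) //; exact: norm_hausdorff.
Qed.

Arguments frame_operatorP : clear implicits.

Lemma frame_operator_unique (f s : V) :
  has_sum (fun k => qdot f (phi k) *h: phi k) s -> L f = s.
Proof. by move=> Hs; exact: has_sum_unique (frame_operatorP f) Hs. Qed.

Lemma frame_operatorD : {morph L : f g / f + g}.
Proof.
move=> f g; apply: frame_operator_unique.
have := has_sumD (frame_operatorP f) (frame_operatorP g).
by congr has_sum; apply/funext => k; rewrite qdotDl qscaleDl.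
Qed.

Lemma frame_operator0 : L 0 = 0.
Proof. by apply: (addrI (L 0)); rewrite -frame_operatorD !addr0. Qed.

Lemma frame_operatorB (f g : V) : L (f - g) = L f - L g.
Proof. by apply: (addIr (L g)); rewrite -frame_operatorD !subrK. Qed.

Lemma frame_operator_sum (J : Type) (r : seq J) (F : J -> V) :
  L (\sum_(i <- r) F i) = \sum_(i <- r) L (F i).
Proof. exact: (big_morph _ frame_operatorD frame_operator0). Qed.

Lemma frame_operatorZ (q : quat R) (f : V) : L (q *h: f) = q *h: L f.
Proof.
apply: frame_operator_unique; apply/has_sumP => e e0.
(* Adding 1 keeps the divisor positive when [q] is 0. *)
have q0 : 0 < `|q| + 1 by rewrite ltr_wpDl.
have /has_sumP/(_ _ (divr_gt0 e0 q0))[A HA] := frame_operatorP f.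
exists A => D /HA; rewrite ltr_pdivlMr // => /(le_lt_trans _); apply.
under eq_bigr do rewrite qdotZl -qscaleA.
rewrite -qscale_sum -qscaleN -qscaleDr normr_qscale mulrC.
by rewrite ler_wpM2l // lerDl.
Qed.

Lemma frame_operator_norm_le (f : V) : `|L f| <= B * `|f|.
Proof.
apply: has_sum_norm_le (frame_operatorP f) _ => A.
rewrite -(@ler_pXn2r R 2) ?nnegrE ?mulr_ge0 ?(ltW B_gt0) //.
rewrite (le_trans (synthesis_norm_le _ _)) // exprMn expr2 -mulrA.
by rewrite ler_wpM2l ?(ltW B_gt0) // bessel.
Qed.

(** * Inverting the frame operator under a lower frame bound *)

Section LowerBound.
Variable a : R.
Hypothesis a_gt0 : 0 < a.
(** The lower frame inequality, stated on finite sums up to [e]: the convergent controlled sum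
    yields it directly in this form. *)
Hypothesis lower_bound : forall (f : V) (e : R), 0 < e ->
  exists A : {fset I}, forall D : {fset I}, (A `<=` D)%fset ->
    a * `|f| ^+ 2 - e <= \sum_(k <- D) `|qdot f (phi k)| ^+ 2.

Lemma frame_operator_coercive (f : V) : a * `|f| ^+ 2 <= rdot (L f) f.
Proof.
apply/ler_addgt0Pr => e e0.
(* This error is paid once in [lower_bound] and, by Cauchy-Schwarz, [|f|] times in the limit, for a
   total of [e]. *)
have e1 : 0 < e / (1 + `|f|) by rewrite divr_gt0 // ltr_wpDr.
have [A HA] := lower_bound f e1.
have /has_sumP/(_ _ e1)[A' HA'] := frame_operatorP f.
have := HA _ (fsubsetUl A A'); have := HA' _ (fsubsetUr A A').
set D := (A `|` A')%fset; set P := \sum_(k <- D) _ *h: _ => HP.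
have -> : \sum_(k <- D) `|qdot f (phi k)| ^+ 2 = rdot P f.
  rewrite /P /rdot qdot_suml qre_sum; apply: eq_bigr => k _.
  by rewrite qdotZl -[qdot (phi k) f]qdotC qmul_conj.
have : rdot (P - L f) f <= e / (1 + `|f|) * `|f|.
  by rewrite (le_trans (rdot_le _ _)) // ler_wpM2r // distrC ltW.
rewrite rdotDl rdotNl.
have -> : e / (1 + `|f|) * `|f| = e - e / (1 + `|f|).
  by field; rewrite gt_eqF // ltr_wpDr.
lra.
Qed.

Lemma frame_operator_norm_ge (f : V) : a * `|f| <= `|L f|.
Proof.
have [->|f0] := eqVneq f 0; first by rewrite normr0 mulr0.
have nf : 0 < `|f| by rewrite normr_gt0.
rewrite -(ler_pM2r nf) -mulrA -expr2.
exact: le_trans (frame_operator_coercive f) (rdot_le _ _).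
Qed.

(** Richardson iteration for [L f = g] with real step [t]; each step sends the residual [r] to
    [r - t L r]. *)
Definition richardson (t : R) (g : V) (n : nat) : V :=
  iter n (fun f => f + qreal t *h: (g - L f)) 0.

Lemma richardson_residual (g : V) : exists t : R,
  (fun n => `|g - L (richardson t g n)|) @ \oo --> (0 : R).
Proof.
(* [M] bounds [L] and exceeds [a]. The choice [t = a / M^2] minimises the contraction factor
   [1 - 2 t a + t^2 M^2], which becomes [kappa = 1 - a^2 / M^2]. *)
pose M := B + a; have M0 : 0 < M by rewrite addr_gt0.
pose t := a / M ^+ 2; have t0 : 0 < t by rewrite divr_gt0 // exprn_gt0.
exists t; pose kappa := 1 - t * a.
have step (r : V) : `|r - qreal t *h: L r| ^+ 2 <= kappa * `|r| ^+ 2.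
  rewrite sqr_normB rdotC rdotZl normr_qscale normq_real (gtr0_norm t0) exprMn.
  have := frame_operator_coercive r.
  rewrite -(ler_pM2l t0) => ler1.
  have : t ^+ 2 * `|L r| ^+ 2 <= t ^+ 2 * (M * `|r|) ^+ 2.
    rewrite ler_wpM2l ?sqr_ge0 // lerXn2r ?nnegrE ?mulr_ge0 ?(ltW M0) //.
    rewrite (le_trans (frame_operator_norm_le r)) // ler_wpM2r //.
    by rewrite lerDl ltW.
  have -> : t ^+ 2 * (M * `|r|) ^+ 2 = t * (a * `|r| ^+ 2).
    by rewrite /t; field; rewrite gt_eqF.
  rewrite /kappa; move: ler1; lra.
have kappa01 : 0 <= kappa < 1.
  apply/andP; split; last by rewrite ltrBlDr ltrDl mulr_gt0.
  rewrite subr_ge0 /t mulrAC -expr2 ler_pdivrMr ?exprn_gt0 // mul1r.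
  by rewrite lerXn2r ?nnegrE ?(ltW M0) ?(ltW a_gt0) // lerDr ltW.
have res n : `|g - L (richardson t g n)| ^+ 2 <= `|g| ^+ 2 * kappa ^+ n.
  elim: n => [|n IH]; first by rewrite /= frame_operator0 subr0 expr0 mulr1.
  rewrite /richardson iterS -/(richardson t g n).
  rewrite frame_operatorD frame_operatorZ opprD addrA.
  rewrite (le_trans (step _)) // [kappa ^+ _]exprS [leRHS]mulrCA ler_wpM2l //.
  by case/andP: kappa01.
apply/cvgrPdist_lt => e e0.
have /(@cvg_geometric R (`|g| ^+ 2)) : `|kappa| < 1.
  by case/andP: kappa01 => k0 k1; rewrite ger0_norm.
move=> /cvgrPdist_lt/(_ (e ^+ 2) (exprn_gt0 _ e0)).
apply: filterS => n; rewrite !sub0r !normrN normr_id => Hn.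
rewrite -(@ltr_pXn2r R 2) ?nnegrE ?(ltW e0) //.
exact: le_lt_trans (res n) (le_lt_trans (ler_norm _) Hn).
Qed.

Lemma frame_operator_surj (g : V) : exists f, L f = g.
Proof.
have [t /cvgrPdist_lt Hres] := richardson_residual g.
set u := richardson t g in Hres.
have small e : 0 < e -> \forall n \near \oo, `|g - L (u n)| < e.
  by move=> /Hres; apply: filterS => n; rewrite sub0r normrN normr_id.
have /cvg_ex[f /cvgrPdist_lt uf] : cvg (u @ \oo).
  (* coercivity bounds [u m - u n] by the difference of the residuals *)
  apply: qcauchy_cvg; apply: cauchy_exP => e e0.
  have d0 : 0 < a * e / 2 by rewrite divr_gt0 // mulr_gt0.
  have [N _ HN] := small _ d0; exists (u N); exists N => // n /= Nn.
  rewrite -ball_normE /ball_ /= -(ltr_pM2l a_gt0).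
  rewrite (le_lt_trans (frame_operator_norm_ge _)) // frame_operatorB.
  have -> : L (u N) - L (u n) = (g - L (u n)) - (g - L (u N)).
    by rewrite opprB [RHS]addrC subrKA.
  rewrite (le_lt_trans (ler_normB _ _)) // [ltRHS]splitr.
  by rewrite ltrD ?HN //=.
exists f; apply/eqP; rewrite eq_sym -subr_eq0 -normr_eq0 eq_le normr_ge0 andbT.
apply/ler_addgt0Pr => e e0; rewrite add0r.
have e2 : 0 < e / 2 by rewrite divr_gt0.
(* The residual at [f] splits into the residual at [u n] and [L (f - u n)]; the bound [B] on [L]
   makes the second at most [e / 2]. *)
have d0 : 0 < e / 2 / B by rewrite divr_gt0.
near \oo => n.
have -> : g - L f = (g - L (u n)) - L (f - u n).
  by rewrite frame_operatorB opprB addrA subrK.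
rewrite (le_trans (ler_normB _ _)) // [leRHS]splitr lerD //.
  by apply: ltW; near: n; exact: small.
rewrite (le_trans (frame_operator_norm_le _)) // mulrC -ler_pdivlMr //.
by apply: ltW; near: n; exact: uf.
Unshelve. all: by end_near. Qed.

Lemma frame_operator_pinvK (g : V) : L (pinv [set: V] L g) = g.
Proof.
by apply: pinvK; have [f <-] := frame_operator_surj g; rewrite inE; exists f.
Qed.

(* [L^-1] is bounded by [1/a], so it may be applied to the sum termwise. *)
Lemma has_sum_canonical_dual (c : I -> quat R) (h : V) :
  has_sum (fun k => c k *h: phi k) (L h) ->
  has_sum (fun k => c k *h: canonical_dual phi k) h.
Proof.
move=> /has_sumP H; apply/has_sumP => e e0.
have [A HA] := H _ (mulr_gt0 a_gt0 e0); exists A => D /HA.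
move=> HD; rewrite -(ltr_pM2l a_gt0) (le_lt_trans (frame_operator_norm_ge _)) //.
rewrite frame_operatorB frame_operator_sum.
under eq_bigr do rewrite frame_operatorZ /canonical_dual frame_operator_pinvK.
exact: HD.
Qed.

End LowerBound.
End Synthesis.

(** * Eigenvalues of self-adjoint and of invertible operators *)

Section Eigenvectors.
Variables (R : realType) (V : qHilbertType R) (C : V -> V).

(** Self-adjointness at [f] equates [|f|^2] times the conjugate of [w] with [w] times [|f|^2], so
    each imaginary component equals its own negative. *)
Lemma self_adjoint_eigenvalue_real (f : V) (w : quat R) :
  self_adjoint C -> f != 0 -> C f = w *h: f -> w = qreal (qre w).
Proof.
move=> selfC f0 Cf; have := selfC f f.
rewrite Cf qdotZr qdotZl qdot_norm.
have n0 : 0 < `|f| ^+ 2 by rewrite exprn_gt0 // normr_gt0.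
have x0 (x : R) : `|f| ^+ 2 * - x = `|f| ^+ 2 * x -> x = 0.
  by move=> /(mulfI (lt0r_neq0 n0)); lra.
case: w {Cf} => a b c d; rewrite -qmul_realC => -[/= _ eb ec ed].
by congr Quat; apply: x0; lra.
Qed.

Lemma self_adjoint_eigenvectors_orthogonal (f g : V) (r s : R) :
  self_adjoint C -> C f = qreal r *h: f -> C g = qreal s *h: g -> r != s ->
  qdot f g = 0.
Proof.
move=> selfC Cf Cg rs; have := selfC g f.
rewrite Cf Cg qdotZr qdotZl qconj_real -qmul_realC.
have cancel (x : R) : s * x = r * x -> x = 0.
  move=> /eqP; rewrite -subr_eq0 -mulrBl mulf_eq0 subr_eq0 eq_sym (negbTE rs).
  by move=> /eqP.
by case: (qdot f g) => a b c d [/= ea eb ec ed]; congr Quat; apply: cancel; lra.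
Qed.

Lemma in_GL_eigenvalue_bounds : in_GL C -> exists a b : R,
  [/\ 0 < a, a <= 1, 1 <= b & forall (f : V) (w : quat R), f != 0 ->
    C f = w *h: f -> a <= `|w| <= b].
Proof.
move=> [_ [M CM] [S [[N SN] SK _]]].
(* The maxima keep both bounds positive and put 1 between them, so that 1 can later serve as the
   eigenvalue at zero vectors. *)
exists (Num.max N 1)^-1, (Num.max M 1); have N1 : 1 <= Num.max N 1.
  by rewrite le_max lexx orbT.
have N0 := lt_le_trans ltr01 N1.
split; rewrite ?invr_gt0 ?invf_le1 ?le_max ?lexx ?orbT // => f w f0 Cf.
have nf : 0 < `|f| by rewrite normr_gt0.
apply/andP; split.
  rewrite -[leLHS]mul1r ler_pdivrMr //.
  have : `|f| <= N * (`|w| * `|f|) by rewrite -normr_qscale -Cf -{1}(SK f).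
  rewrite mulrA -[leLHS]mul1r ler_pM2r // => /le_trans; apply.
  by rewrite mulrC ler_wpM2l // le_max lexx.
have : `|w| * `|f| <= M * `|f| by rewrite -normr_qscale -Cf.
by rewrite ler_pM2r // le_max => ->.
Qed.

End Eigenvectors.

(** * From the controlled frame to the multiplier *)

Section ControlledFrame.
Variables (R : realType) (V : qHilbertType R) (I : countType).
Variables (phi : I -> V) (C : V -> V) (om : I -> quat R).
Hypotheses (selfC : self_adjoint C) (diagC : diagonal_with C phi om).

Lemma diagonal_real k : phi k != 0 -> om k = qreal (qre (om k)).
Proof. by move=> phik0; apply: self_adjoint_eigenvalue_real (diagC k). Qed.

(** A real [om k] moves out of the product, leaving a squared modulus; where [phi k] is 0 both terms
    vanish, whatever [om k] is. *)
Lemma controlled_sum (f : V) (s : R) :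
  has_sum (fun k => qdot f (phi k) * qdot (C (phi k)) f) (qreal s) ->
  has_sum (fun k => qre (om k) * `|qdot f (phi k)| ^+ 2) s.
Proof.
move=> Hs; apply: has_sum_qreal; move: Hs.
congr has_sum; apply/funext => k; rewrite diagC qdotZl.
have [->|/diagonal_real ->] := eqVneq (phi k) 0.
  by rewrite !qdot0r !qdot0l mul0r normr0 expr0n mulr0.
by rewrite mulrA -qmul_realC -mulrA -[qdot (phi k) f]qdotC qmul_conj qrealM.
Qed.

(* Eigenvectors with distinct eigenvalues are orthogonal, so testing the lower
   frame bound on [phi j] leaves only terms with eigenvalue [om j]. *)
Lemma controlled_eigenvalue_gt0 j :
  controlled_frame C phi -> phi j != 0 -> 0 < qre (om j).
Proof.
move=> [A [B [A0 _ AB]]] phij0.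
have [s /controlled_sum/has_sumP us /andP[As _]] := AB (phi j).
have s0 : 0 < s.
  by apply: lt_le_trans As; rewrite mulr_gt0 // exprn_gt0 // normr_gt0.
(* Tolerance [s] around the sum [s] produces a strictly positive finite sum, which is impossible if
   every term is at most 0. *)
have [D /(_ _ (fsubset_refl D))] := us s s0.
rewrite ltr_norml => /andP[_]; rewrite ltrBlDl ltrDr => sum0.
rewrite ltNge; apply/negP => omj0.
suff /le_lt_trans/(_ sum0) :
  \sum_(k <- D) qre (om k) * `|qdot (phi j) (phi k)| ^+ 2 <= 0.
  by rewrite ltxx.
apply: sumr_le0 => k _; have [->|phik0] := eqVneq (phi k) 0.
  by rewrite qdot0r normr0 expr0n mulr0.
have [<-|jk] := eqVneq (qre (om j)) (qre (om k)).
  by rewrite mulr_le0_ge0 ?sqr_ge0.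
rewrite (self_adjoint_eigenvectors_orthogonal selfC _ _ jk).
- by rewrite normr0 expr0n mulr0.
- by rewrite -diagonal_real.
- by rewrite -diagonal_real.
Qed.

Lemma diagonal_multiplier : in_GL C -> controlled_frame C phi ->
  is_frame_multiplier om (canonical_dual phi) phi C.
Proof.
move=> glC frameC.
have [al [be [al0 al1 be1 ombound]]] := in_GL_eigenvalue_bounds glC.
have be0 := lt_le_trans ltr01 be1.
(* Comparing weighted with unweighted terms turns the controlled bounds [A], [B] into the frame
   bounds [A / be], [B / al]. *)
have om_qre k (f : V) : al * `|qdot f (phi k)| ^+ 2 <=
    qre (om k) * `|qdot f (phi k)| ^+ 2 <= be * `|qdot f (phi k)| ^+ 2.
  have [->|phik0] := eqVneq (phi k) 0.
    by rewrite qdot0r normr0 expr0n !mulr0 lexx.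
  have := ombound _ _ phik0 (diagC k).
  rewrite (diagonal_real phik0) normq_real.
  rewrite (gtr0_norm (controlled_eigenvalue_gt0 frameC phik0)) => /andP[? ?].
  by rewrite !ler_wpM2r ?sqr_ge0.
move: (frameC) => [A [B [A0 leAB AB]]].
have B0 : 0 < B / al by rewrite divr_gt0 // (lt_le_trans A0).
have bessel (f : V) (D : {fset I}) :
    \sum_(k <- D) `|qdot f (phi k)| ^+ 2 <= B / al * `|f| ^+ 2.
  have [s /controlled_sum us /andP[_ sB]] := AB f.
  rewrite mulrAC ler_pdivlMr // mulrC mulr_sumr (le_trans _ sB) //.
  apply: le_trans (fsum_le_has_sum D _ us).
    by apply: ler_sum => k _; case/andP: (om_qre k f).
  move=> k; case/andP: (om_qre k f) => + _; apply: le_trans.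
  by rewrite mulr_ge0 ?sqr_ge0 // ltW.
have a0 : 0 < A / be by rewrite divr_gt0.
have lower_bound (f : V) (e : R) : 0 < e -> exists D : {fset I},
    forall D' : {fset I}, (D `<=` D')%fset ->
    A / be * `|f| ^+ 2 - e <= \sum_(k <- D') `|qdot f (phi k)| ^+ 2.
  move=> e0; have [s /controlled_sum/has_sumP us /andP[As _]] := AB f.
  have [D HD] := us _ (mulr_gt0 be0 e0); exists D => D' /HD.
  rewrite ltr_norml => /andP[_ Hs]; rewrite -(ler_pM2l be0) mulr_sumr.
  have : \sum_(k <- D') qre (om k) * `|qdot f (phi k)| ^+ 2 <=
      \sum_(k <- D') be * `|qdot f (phi k)| ^+ 2.
    by apply: ler_sum => k _; case/andP: (om_qre k f).
  have -> : be * (A / be * `|f| ^+ 2 - e) = A * `|f| ^+ 2 - be * e.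
    by field; rewrite gt_eqF.
  by lra.
move=> h; apply: (has_sum_canonical_dual B0 bessel a0 lower_bound).
have := @frame_operatorP _ _ _ _ _ B0 bessel (C h).
congr has_sum; apply/funext => k.
(* Self-adjointness moves [C] onto [phi k]; the resulting conjugate of [om k] is [om k] itself and
   commutes to the left. *)
rewrite -(selfC (phi k) h) diagC qdotZr.
have [->|/diagonal_real ->] := eqVneq (phi k) 0; first by rewrite !qscale0r.
by rewrite qconj_real qmul_realC.
Qed.

End ControlledFrame.

Theorem proposition4p4 (R : realType) (V : qHilbertType R) (I : countType)
    (phi : I -> V) (C : V -> V) :
  separable V ->
  in_GL C ->
  self_adjoint C ->
  diagonal_on C phi ->
  controlled_frame C phi ->
  (exists om : I -> quat R,
     [/\ diagonal_with C phi om, semi_normalized_on [set: I] om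
       & positive_on [set: I] om]) /\
  (forall om : I -> quat R, diagonal_with C phi om ->
     [/\ semi_normalized_on [set k | phi k != 0] om,
         positive_on [set k | phi k != 0] om
       & is_frame_multiplier om (canonical_dual phi) phi C]).
Proof.
move=> _ glC selfC diagC frameC.
have [a [b [a0 a1 b1 ombound]]] := in_GL_eigenvalue_bounds glC.
have pos (om : I -> quat R) k : diagonal_with C phi om -> phi k != 0 ->
    exists2 r : R, 0 < r & om k = qreal r.
  move=> omP phik0; exists (qre (om k)); last exact: diagonal_real omP _ phik0.
  exact: controlled_eigenvalue_gt0 omP _ frameC phik0.
split; last first.
  move=> om omP; split.
  - exists a, b; split => // [|k phik0]; first exact: le_trans b1.
    exact: ombound phik0 (omP k).
  - by move=> k /(pos _ _ omP).
  - exact: diagonal_multiplier.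
have [om omP] := choice diagC.
(* At zero vectors any scalar is an eigenvalue; 1 is positive and lies within the bounds [a] and
   [b]. *)
exists (fun k => if phi k == 0 then 1 else om k); split.
- move=> k; have [phik0|_] := eqVneq (phi k) 0; last exact: omP.
  by rewrite omP phik0 !qscale0r.
- exists a, b; split => //; first exact: le_trans b1.
  move=> k _; have [_|phik0] := eqVneq (phi k) 0; last exact: ombound phik0 (omP k).
  by rewrite (_ : 1 = qreal 1 :> quat R) // normq_real normr1 a1.
- move=> k _; have [_|] := eqVneq (phi k) 0; first by exists 1.
  exact: pos.
Qed.
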